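(* Let $G$ and $H$ be countable discrete groups with property A, and let $K$ be a common subgroup of $G$ and $H$. Then the amalgamated free product $F=G\ast_K H$ has property A.
   Context: Property A: a discrete metric space $(X,d)$ has property A if for all $R,\epsilon>0$ there exists a family $\{A_x\}_{x\in X}$ of finite, non-empty subsets of $X\times\mathbb{N}$ such that (i) for all $x,y\in X$ with $d(x,y)\le R$ we have $\frac{|A_x\triangle A_y|}{|A_x\cap A_y|}<\epsilon$; (ii) there exists $S$ such that for each $x\in X$, if $(y,n)\in A_x$ then $d(x,y)\le S$. Groups as metric spaces: a discrete metric space $X$ has bounded geometry if for all $r>0$ there is $N_r$ with $|B(x,r)|<N_r$ for all $x\in X$. Every countable discrete group $G$ admits a left-invariant metric ($d(hg,hg')=d(g,g')$) of bounded geometry, and any two such metrics are coarsely equivalent via the identity map. A countable discrete group is said to have property A if it has property A as a metric space with respect to some (equivalently, every) left-invariant bounded geometry metric. *)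

(* Defs.v *)
From HB Require Import structures.
From mathcomp Require Import all_boot all_order all_algebra.
From mathcomp Require Import finmap.
From mathcomp Require Import boolp classical_sets functions cardinality reals.
From mathcomp Require Import generic_quotient.

Set Implicit Arguments.
Unset Strict Implicit.
Unset Printing Implicit Defensive.

Import Order.TTheory GRing.Theory Num.Theory.

Local Open Scope classical_set_scope.
Local Open Scope fset_scope.
Local Open Scope ring_scope.

(* Distances are bare functions rather than instances of [metricType], because
   a group carries many metrics and property A quantifies over them. *)
Record discrete_metric (R : realType) (X : Type) (d : X -> X -> R) : Prop :=
  DiscreteMetric {
    dist_ge0 : forall x y, 0 <= d x y ;
    dist_eq0 : forall x y, d x y = 0 <-> x = y ;
    dist_sym : forall x y, d x y = d y x ;
    dist_triangle : forall x y z, d x z <= d x y + d y z ;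
    dist_discrete : forall x, exists2 r, 0 < r & forall y, d x y < r -> y = x
  }.

(* [fset_set] of an infinite set is empty, so finiteness of the balls has to be
   required separately from the bound on their cardinality. *)
Definition bounded_geometry (R : realType) (X : choiceType)
    (d : X -> X -> R) : Prop :=
  forall r : R, 0 < r -> exists N : nat, forall x : X,
    let B := [set y | d x y <= r] in
    finite_set B /\ (#|` fset_set B| < N)%N.

(* Division is total with [a / 0 = 0]; the condition that A_x and A_y meet is
   implicit in writing the quotient and has to be made explicit. *)
Definition property_A (R : realType) (X : choiceType)
    (d : X -> X -> R) : Prop :=
  forall r e : R, 0 < r -> 0 < e ->
  exists A : X -> {fset X * nat},
    [/\ forall x, A x != fset0,
        forall x y, d x y <= r ->
          A x `&` A y != fset0 /\
          #|` (A x `\` A y) `|` (A y `\` A x)|%:R / #|` A x `&` A y|%:R < e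
      & exists S : R, forall x p, p \in A x -> d x p.1 <= S].

Definition left_invariant (R : realType) (G : groupType)
    (d : G -> G -> R) : Prop :=
  forall h g g' : G, d (h * g)%g (h * g')%g = d g g'.

Definition group_property_A (R : realType) (G : groupType) : Prop :=
  exists d : G -> G -> R,
    [/\ discrete_metric d, left_invariant d, bounded_geometry d
      & property_A d].

(* F, with the maps jG and jH, is the amalgamated free product of G and H over
   K, i.e. the pushout of iG and iH in the category of groups. *)
Definition is_amalgam (K G H F : groupType)
    (iG : {multiplicative K -> G}) (iH : {multiplicative K -> H})
    (jG : {multiplicative G -> F}) (jH : {multiplicative H -> F}) : Prop :=
  (forall k, jG (iG k) = jH (iH k)) /\
  forall (P : groupType)
    (f : {multiplicative G -> P}) (g : {multiplicative H -> P}),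
    (forall k, f (iG k) = g (iH k)) ->
    exists h : {multiplicative F -> P},
      [/\ forall x, h (jG x) = f x,
          forall y, h (jH y) = g y
        & forall h' : {multiplicative F -> P},
            (forall x, h' (jG x) = f x) -> (forall y, h' (jH y) = g y) ->
            h' =1 h].

(* Existence of amalgamated free products: words in the letters of G and H,
   two words being identified when they have the same value in every group
   receiving compatible morphisms from G and H. *)
Section AmalgamExists.
Variables (K G H : groupType).
Variables (iG : {multiplicative K -> G}) (iH : {multiplicative K -> H}).
Local Open Scope group_scope.
Local Open Scope quotient_scope.

Let word := seq (G + H).

Definition word_eval (P : groupType) (f : G -> P) (g : H -> P) (w : word) : P :=
  \prod_(s <- w) match s with inl x => f x | inr y => g y end.

Definition word_equiv (w w' : word) : bool :=
  `[< forall (P : groupType)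
        (f : {multiplicative G -> P}) (g : {multiplicative H -> P}),
        (forall k, f (iG k) = g (iH k)) ->
        word_eval f g w = word_eval f g w' >].

Lemma word_equiv_is_equiv : equiv_class_of word_equiv.
Proof.
split=> [w | w w' | w2 w1 w3 /asboolP e12 /asboolP e23]; first exact/asboolP.
  by apply/asboolP/asboolP => e P f g fg; rewrite e.
by apply/asboolP => P f g fg; rewrite e12// e23.
Qed.

Canonical word_equiv_equiv := EquivRelPack word_equiv_is_equiv.

Definition amalgam := {eq_quot word_equiv}.
HB.instance Definition _ := Choice.on amalgam.

Let cls (w : word) : amalgam := \pi_{eq_quot word_equiv} w.
Let rep (x : amalgam) : word := repr (x : {eq_quot word_equiv}).

Let cls_eq w w' : word_equiv w w' -> cls w = cls w'.
Proof. by move=> e; apply/eqmodP. Qed.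

Let repK x : cls (rep x) = x. Proof. exact: reprK. Qed.

Let rep_cls w : word_equiv (rep (cls w)) w.
Proof. by apply/eqmodP; rewrite reprK. Qed.

Let eval_rep_cls (P : groupType)
    (f : {multiplicative G -> P}) (g : {multiplicative H -> P}) w :
  (forall k, f (iG k) = g (iH k)) ->
  word_eval f g (rep (cls w)) = word_eval f g w.
Proof. by have /asboolP := rep_cls w; apply. Qed.

Let eval_cat (P : groupType) (f : G -> P) (g : H -> P) v w :
  word_eval f g (v ++ w) = word_eval f g v * word_eval f g w.
Proof. exact: big_cat. Qed.

Let winv (w : word) : word :=
  rev [seq match s with inl x => inl x^-1 | inr y => inr y^-1 end | s <- w].

Let eval_inv (P : groupType)
    (f : {multiplicative G -> P}) (g : {multiplicative H -> P}) w :
  word_eval f g (winv w) = (word_eval f g w)^-1.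
Proof.
have hV (Q : groupType) (h : {multiplicative Q -> P}) x : h x^-1 = (h x)^-1.
  have h1 : h 1 = 1 by apply: (mulgI (h 1)); rewrite -gmulfM !mulg1.
  by apply: (mulgI (h x)); rewrite -gmulfM !mulgV.
rewrite /winv /word_eval; elim: w => [|s w IHw]; first by rewrite !big_nil invg1.
rewrite big_cons invgM -IHw /= rev_cons -cats1 big_cat big_seq1.
by case: s => z; rewrite hV.
Qed.

Let mul (x y : amalgam) := cls (rep x ++ rep y).
Let one := cls [::].
Let inv (x : amalgam) := cls (winv (rep x)).

Let amalgam_ext (x y : amalgam) :
  (forall (P : groupType)
     (f : {multiplicative G -> P}) (g : {multiplicative H -> P}),
     (forall k, f (iG k) = g (iH k)) ->
     word_eval f g (rep x) = word_eval f g (rep y)) -> x = y.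
Proof. by move=> e; rewrite -(repK x) -(repK y); apply: cls_eq; apply/asboolP. Qed.

Let mulA : associative mul.
Proof.
move=> x y z; apply: amalgam_ext => P f g fg.
by rewrite !(eval_rep_cls, eval_cat)// mulgA.
Qed.

Let mul1 : left_id one mul.
Proof.
move=> x; apply: amalgam_ext => P f g fg.
by rewrite !(eval_rep_cls, eval_cat)// /word_eval big_nil mul1g.
Qed.

Let mulx1 : right_id one mul.
Proof.
move=> x; apply: amalgam_ext => P f g fg.
by rewrite !(eval_rep_cls, eval_cat)// /word_eval big_nil mulg1.
Qed.

Let mulV : left_inverse one inv mul.
Proof.
move=> x; apply: amalgam_ext => P f g fg.
by rewrite !(eval_rep_cls, eval_cat, eval_inv)// mulVg /word_eval big_nil.
Qed.

Let mulxV : right_inverse one inv mul.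
Proof.
move=> x; apply: amalgam_ext => P f g fg.
by rewrite !(eval_rep_cls, eval_cat, eval_inv)// mulgV /word_eval big_nil.
Qed.

HB.instance Definition _ := isGroup.Build amalgam mulA mul1 mulx1 mulV mulxV.

Definition amalgam_inl (x : G) : amalgam := cls [:: inl x].
Definition amalgam_inr (y : H) : amalgam := cls [:: inr y].

Let amalgam_inlM : {morph amalgam_inl : x y / x * y}.
Proof.
move=> x y; apply: amalgam_ext => P f g fg.
by rewrite !(eval_rep_cls, eval_cat)// /word_eval !big_seq1 gmulfM.
Qed.

Let amalgam_inrM : {morph amalgam_inr : x y / x * y}.
Proof.
move=> x y; apply: amalgam_ext => P f g fg.
by rewrite !(eval_rep_cls, eval_cat)// /word_eval !big_seq1 gmulfM.
Qed.

HB.instance Definition _ := isMultiplicative.Build G amalgam amalgam_inl amalgam_inlM.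
HB.instance Definition _ := isMultiplicative.Build H amalgam amalgam_inr amalgam_inrM.

Let amalgam_prod (x : amalgam) :
  x = \prod_(s <- rep x)
        match s with inl a => amalgam_inl a | inr b => amalgam_inr b end.
Proof.
rewrite -[LHS]repK; elim: (rep x) => [|s w IHw]; first by rewrite big_nil.
rewrite big_cons -IHw; apply: amalgam_ext => P f g fg.
case: s => z; rewrite !(eval_rep_cls, eval_cat)//.
  by rewrite /word_eval big_cons big_seq1.
by rewrite /word_eval big_cons big_seq1.
Qed.

Lemma amalgam_is_amalgam : is_amalgam iG iH amalgam_inl amalgam_inr.
Proof.
split=> [k|P f g fg].
  apply: amalgam_ext => P f g fg.
  by rewrite !eval_rep_cls// /word_eval !big_seq1.
pose h (x : amalgam) := word_eval f g (rep x).
have hM : {morph h : x y / x * y}.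
  by move=> x y; rewrite /h eval_rep_cls// eval_cat.
pose hm : {multiplicative amalgam -> P} :=
  HB.pack h (isMultiplicative.Build amalgam P h hM).
exists hm; split=> [x|y|h' h'G h'H x].
- by rewrite /= /h eval_rep_cls// /word_eval big_seq1.
- by rewrite /= /h eval_rep_cls// /word_eval big_seq1.
have h'1 : h' 1 = 1 by apply: (mulgI (h' 1)); rewrite -gmulfM !mulg1.
rewrite /= /h {1}[x]amalgam_prod /word_eval (big_morph h' (@gmulfM _ _ h') h'1).
by apply: eq_bigr => -[a|b] _.
Qed.

End AmalgamExists.

(* Main.v *)
From HB Require Import structures.
Require Import Defs.
From mathcomp Require Import all_boot all_order all_algebra finmap.
From mathcomp Require Import boolp classical_sets functions cardinality reals.
From mathcomp Require Import zify ring lra.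

(* Property A is used in its measure form: every x carries a probability measure
   supported near x, and close points carry measures that are close in l^1.

   Orient every edge xK of the Bass-Serre tree (whose vertices are the cosets xG
   and xH) towards a root; each vertex then has a parent.  From the vertex xG,
   walk towards the root, stopping before the first vertex whose coset is at
   distance more than t from x, and look at the first n vertices of this walk.
   Each of them is a coset at distance at most t from x, and so carries, by
   property A of G or H, a measure sitting near a point of it closest to x;
   average these measures over the n steps and over all t < T.  If s is a letter
   of length at most L, the walks of x and xs merge after at most two steps, and
   then coincide for n steps unless t separates the distances of x and xs to
   one of n cosets, which happens for at most (n+1)L values of t.  So the
   averages of x and xs are close once n is large with respect to L and T with
   respect to nL.

   The orientation comes from a right action of F on [bool * nat * K] given by
   the universal property: the tag of the image of a base point under x orients
   the edge xK. *)

Set Implicit Arguments.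
Unset Strict Implicit.
Unset Printing Implicit Defensive.

Import Order.TTheory GRing.Theory Num.Theory.

Local Open Scope classical_set_scope.
Local Open Scope fset_scope.
Local Open Scope ring_scope.

(** * Actions of the factors *)

Lemma gmulf1_group (G H : groupType) (f : {multiplicative G -> H}) : f 1%g = 1%g.
Proof. by apply: (mulgI (f 1%g)); rewrite -gmulfM !mulg1. Qed.

Lemma gmulfV_group (G H : groupType) (f : {multiplicative G -> H}) x :
  f x^-1%g = (f x)^-1%g.
Proof. by apply: (mulgI (f x)); rewrite -gmulfM !mulgV gmulf1_group. Qed.

Lemma countable_infinite_enum (T : Type) (A : set T) :
  countable A -> infinite_set A ->
  exists (e : T -> nat) (e' : nat -> T),
    [/\ forall x, A x -> e' (e x) = x, forall n, A (e' n)
      & forall n, e (e' n) = n].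
Proof.
move=> cA iA.
have /card_set_bijP[e [_ einj esurj]] := eq_card_nat cA iA.
have /choice[e' e'P] : forall n, exists x, A x /\ e x = n.
  by move=> n; have [x Ax <-] := esurj n I; exists x.
exists e, e'; split=> [x Ax|n|n]; try by have [] := e'P n.
have [Ae' ee'] := e'P (e x).
by apply: einj; rewrite ?inE.
Qed.

(** * Subgroups and their left cosets *)

Section Subgroups.
Variables (F : groupType) (A : set F).
Local Open Scope group_scope.

Definition is_subgroup := A 1 /\ forall x y, A x -> A y -> A (x^-1 * y).

(** The choice is made from the coset as a set, so all its elements get the same representative. *)
Definition coset_rep (x : F) : F := xget 1 [set y | A (x^-1 * y)].

Hypothesis sA : is_subgroup.

Lemma subgroupV x : A x -> A x^-1.
Proof. by move=> Ax; have := sA.2 _ _ Ax sA.1; rewrite mulg1. Qed.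

Lemma subgroupM x y : A x -> A y -> A (x * y).
Proof. by move=> /subgroupV Ax Ay; have := sA.2 _ _ Ax Ay; rewrite invgK. Qed.

Lemma coset_repP x : A (x^-1 * coset_rep x).
Proof.
rewrite /coset_rep; apply: (@xgetPex _ 1 [set y | A (x^-1 * y)]).
by exists x; rewrite /= mulVg; apply: sA.1.
Qed.

Lemma coset_rep_eq x y : A (x^-1 * y) -> coset_rep x = coset_rep y.
Proof.
move=> Axy; rewrite /coset_rep; congr (xget _ _); apply/seteqP; split=> z /= Az.
  by have := sA.2 _ _ Axy Az; rewrite invgM invgK mulgA mulgK.
by have := subgroupM Axy Az; rewrite mulgA mulgK.
Qed.

Lemma coset_rep_id x : coset_rep (coset_rep x) = coset_rep x.
Proof. by apply/esym/coset_rep_eq/coset_repP. Qed.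

Lemma coset_repV x : A ((coset_rep x)^-1 * x).
Proof. by have := subgroupV (coset_repP x); rewrite invgM invgK. Qed.

End Subgroups.

Lemma range_subgroup (G F : groupType) (f : {multiplicative G -> F}) :
  is_subgroup (range f).
Proof.
split; first by exists 1%g => //; exact: gmulf1_group.
by move=> _ _ [x _ <-] [y _ <-]; exists (x^-1 * y)%g => //; rewrite gmulfM gmulfV_group.
Qed.

(* Each $K$-orbit of [bool * nat * K] is free; the action of $G$ glues one
   $K$-orbit of tag [b] to $K$-orbits of tag [~~ b] in every $G$-orbit that
   meets the tag [b]. *)
Lemma stable_action (K G : groupType) (i : {multiplicative K -> G}) (b : bool) :
  injective i -> countable [set: G] ->
  exists a : bool * nat * K -> G -> bool * nat * K,
    [/\ forall w, a w 1%g = w,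
        forall w g h, a (a w g) h = a w (g * h)%g,
        forall w k, a w (i k) = (w.1, w.2 * k)%g
      & forall n k g, (a (b, n, k) g).1.1 = b -> range i g].
Proof.
move=> i_inj cG; pose sK := range_subgroup i.
pose c := coset_rep (range i).
have /choice[kap kapP] : forall g, exists k, (c g * i k)%g = g.
  by move=> g; have [k _ ck] := coset_repV sK g; exists k; rewrite ck mulVKg.
have cM g k : c (g * i k)%g = c g.
  by apply/esym/(coset_rep_eq sK); rewrite mulKg; exists k.
have kapM g k : kap (g * i k)%g = (kap g * k)%g.
  by apply: i_inj; apply: (mulgI (c g)); rewrite -{1}(cM g k) kapP gmulfM mulgA kapP.
have kapc g : kap (c g) = 1%g.
  apply: i_inj; apply: (mulgI (c (c g))).
  by rewrite kapP gmulf1_group mulg1 /c coset_rep_id.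
(* The copies of [G] indexed by [bool * nat] are cut into left cosets of [K]. [O] lists those that
   will get the tag [~~ b]: all but the trivial coset in the copies of tag [b]. *)
pose O := [set p : bool * nat * G | c p.2 = p.2 /\ ~ (p.1.1 = b /\ range i p.2)].
have cO : countable O.
  apply: (@sub_countable _ _ _ ([set: bool * nat] `*` [set: G])%classic).
    exact/subset_card_le.
  by apply: countableX => //; apply: countableP.
have iO : infinite_set O.
  (* The copies of tag [~~ b] keep [O] infinite even when [K] is all of [G]. *)
  pose f n : bool * nat * G := (~~ b, n, c 1%g).
  have finj : {in setT &, injective f} by move=> n m _ _ [].
  apply: (@sub_infinite_set _ (f @` setT)).
    move=> _ [n _ <-]; rewrite /O /f /= /c coset_rep_id//; split=> // -[].
    by case: (b).
  by apply: contra_not infinite_nat; rewrite (eq_finite_set (inj_card_eq finj)).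
have [e [e' [eK Oe' e'K]]] := countable_infinite_enum cO iO.
(* A [K]-equivariant bijection with inverse [psi]: the trivial coset of the [n]-th copy of tag [b]
   becomes the orbit [(b, n)], and [e] numbers the other cosets. *)
pose phi (y : bool * nat * G) : bool * nat * K :=
  if `[< y.1.1 = b /\ range i y.2 >] then (b, y.1.2, kap y.2)
  else (~~ b, e (y.1, c y.2), kap y.2).
pose psi (w : bool * nat * K) : bool * nat * G :=
  if w.1.1 == b then (b, w.1.2, c 1 * i w.2)%g
  else ((e' w.1.2).1, (e' w.1.2).2 * i w.2)%g.
have rangeM g k : range i (g * i k)%g <-> range i g.
  split=> [gk|ig]; last by apply: subgroupM => //; exists k.
  have := subgroupM sK gk (subgroupV sK (imageP i (I : setT k))).
  by rewrite mulgK.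
have range_c g : range i (c g) <-> range i g.
  by rewrite -{2}(kapP g) rangeM.
have c1 : range i (c 1%g) by apply/range_c; exact: sK.1.
have phiM p g k : phi (p, g * i k)%g = ((phi (p, g)).1, (phi (p, g)).2 * k)%g.
  rewrite /phi /= cM kapM.
  rewrite (asbool_equiv_eq (_ : (_ /\ range i (g * i k)%g) <-> (p.1 = b /\ range i g))).
    by case: ifP.
  by rewrite rangeM.
have psiK w : phi (psi w) = w.
  case: w => [[t n] k]; rewrite /psi /=; case: eqP => [->|tb]; rewrite phiM /phi /=.
    by rewrite asboolT //= kapc mul1g.
  have [/= cE nE] := Oe' n.
  rewrite asboolF //= -{2}cE kapc mul1g cE -surjective_pairing e'K.
  by case: (t) (b) tb => -[].
have phiK y : psi (phi y) = y.
  case: y => [[t n] g]; rewrite /phi /=; case: asboolP => [[-> ig]|ng]; rewrite /psi /=.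
    have -> : c 1%g = c g by apply: (coset_rep_eq sK); rewrite invg1 mul1g.
    by rewrite eqxx kapP.
  rewrite [_ == _](_ : _ = false); last by case: (b).
  rewrite eK /= ?kapP//; split=> /=; first by rewrite /c coset_rep_id.
  by move=> [tb /range_c ig]; apply: ng; split.
(* Right translation by [G] on the copies, transported along [phi]. *)
exists (fun w g => phi ((psi w).1, (psi w).2 * g)%g); split=> [w|w g h|w k|n k g].
- by rewrite mulg1 -surjective_pairing.
- by rewrite phiK /= mulgA.
- by rewrite phiM -surjective_pairing psiK.
(* Tag [b] before and after means that [g] moves a point of the trivial coset within that coset. *)
rewrite /psi /= eqxx /= /phi /=; case: asboolP => /= [[_ ckg] _|_]; last by case: (b).
have := sK.2 _ _ ((rangeM (c 1%g) k).2 c1) ckg.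
by rewrite mulKg.
Qed.

(** * The group of bijections of a type *)

Record bijection (T : Type) := Bijection {
  bij_fun : T -> T;
  bij_inv : T -> T;
  bij_funK : cancel bij_fun bij_inv;
  bij_invK : cancel bij_inv bij_fun }.

Section BijectionGroup.
Variable T : Type.

HB.instance Definition _ := gen_eqMixin (bijection T).
HB.instance Definition _ := gen_choiceMixin (bijection T).

Lemma bijection_ext (p q : bijection T) : bij_fun p =1 bij_fun q -> p = q.
Proof.
case: p q => [f f' fK f'K] [g g' gK g'K] /= /funext fg; subst g.
have fg' : f' = g' by apply/funext => x; rewrite -{1}[x]g'K fK.
by subst g'; congr Bijection; apply: Prop_irrelevance.
Qed.

(* Products are read from left to right, so that morphisms into this group are
   right actions. *)
Definition bij_mul (p q : bijection T) : bijection T :=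
  Bijection (can_comp (bij_funK q) (bij_funK p))
            (can_comp (bij_invK p) (bij_invK q)).
Definition bij_one : bijection T :=
  @Bijection T id id (fun=> erefl) (fun=> erefl).
Definition bij_inverse (p : bijection T) : bijection T :=
  Bijection (bij_invK p) (bij_funK p).

Lemma bij_mulA : associative bij_mul.
Proof. by move=> p q r; apply: bijection_ext. Qed.
Lemma bij_mul1 : left_id bij_one bij_mul.
Proof. by move=> p; apply: bijection_ext. Qed.
Lemma bij_mulx1 : right_id bij_one bij_mul.
Proof. by move=> p; apply: bijection_ext. Qed.
Lemma bij_mulV : left_inverse bij_one bij_inverse bij_mul.
Proof. by move=> p; apply: bijection_ext => x /=; rewrite bij_invK. Qed.
Lemma bij_mulxV : right_inverse bij_one bij_inverse bij_mul.
Proof. by move=> p; apply: bijection_ext => x /=; rewrite bij_funK. Qed.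

HB.instance Definition _ :=
  isGroup.Build (bijection T) bij_mulA bij_mul1 bij_mulx1 bij_mulV bij_mulxV.

Lemma action_morphism (G : groupType) (a : T -> G -> T) :
  (forall w, a w 1%g = w) -> (forall w g h, a (a w g) h = a w (g * h)%g) ->
  exists f : {multiplicative G -> bijection T}, forall g w, bij_fun (f g) w = a w g.
Proof.
move=> a1 aM.
have aK g : cancel (a^~ g) (a^~ g^-1%g) by move=> w; rewrite aM mulgV a1.
have aVK g : cancel (a^~ g^-1%g) (a^~ g) by move=> w; rewrite aM mulVg a1.
pose f g := Bijection (aK g) (aVK g).
have fM : {morph f : x y / (x * y)%g}.
  by move=> x y; apply: bijection_ext => w /=; rewrite aM.
pose fm : {multiplicative G -> bijection T} :=
  HB.pack f (isMultiplicative.Build G (bijection T) f fM).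
by exists fm.
Qed.
End BijectionGroup.

(** * Orientation of the tree, and generation by the factors *)

Section Amalgam.
Variables (K G H F : groupType).
Variables (iG : {multiplicative K -> G}) (iH : {multiplicative K -> H}).
Variables (jG : {multiplicative G -> F}) (jH : {multiplicative H -> F}).
Hypothesis F_amalgam : is_amalgam iG iH jG jH.

(* The vertices of the Bass-Serre tree are the cosets [x G] and [x H], its edges
   the cosets [x K]; [o x] tells that the edge [x K] leaves the vertex [x G]
   towards the root. *)
Lemma amalgam_orientation :
  injective iG -> injective iH -> countable [set: G] -> countable [set: H] ->
  [/\ injective jG, injective jH & exists o : F -> bool,
     (forall x g, o x -> o (x * jG g)%g -> range iG g) /\
     (forall x h, ~~ o x -> ~~ o (x * jH h)%g -> range iH h)].
Proof.
move=> iG_inj iH_inj cG cH.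
have [aG [aG1 aGM aGK aGo]] := stable_action true iG_inj cG.
have [aH [aH1 aHM aHK aHo]] := stable_action false iH_inj cH.
have [fG fGE] := action_morphism aG1 aGM.
have [fH fHE] := action_morphism aH1 aHM.
(* Both actions restrict to right translation of the last coordinate on [K], so they glue to an
   action of [F]. *)
have [|f [fjG fjH _]] := F_amalgam.2 _ fG fH.
  by move=> k; apply: bijection_ext => w; rewrite fGE fHE aGK aHK.
pose act w x := bij_fun (f x) w.
have actM w x y : act w (x * y)%g = act (act w x) y by rewrite /act gmulfM.
have act1 w : act w 1%g = w by rewrite /act gmulf1_group.
have actG w g : act w (jG g) = aG w g by rewrite /act fjG fGE.
have actH w h : act w (jH h) = aH w h by rewrite /act fjH fHE.
split.
(* An element killed by [jG] acts trivially; it preserves the tag [true], so it comes from [K],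
   which acts freely. *)
- have jG1 g : jG g = 1%g -> g = 1%g.
    move=> jg; have ag w : aG w g = w by rewrite -actG jg act1.
    have [k _ kg] : range iG g by apply: (aGo 0%N 1%g); rewrite ag.
    have := ag (true, 0%N, 1%g); rewrite -kg aGK mul1g => -[->].
    exact: gmulf1_group.
  move=> x y xy; apply: (mulgI x^-1%g); rewrite mulVg.
  by apply/esym/jG1; rewrite gmulfM gmulfV_group xy mulVg.
- have jH1 g : jH g = 1%g -> g = 1%g.
    move=> jg; have ag w : aH w g = w by rewrite -actH jg act1.
    have [k _ kg] : range iH g by apply: (aHo 0%N 1%g); rewrite ag.
    have := ag (false, 0%N, 1%g); rewrite -kg aHK mul1g => -[->].
    exact: gmulf1_group.
  move=> x y xy; apply: (mulgI x^-1%g); rewrite mulVg.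
  by apply/esym/jH1; rewrite gmulfM gmulfV_group xy mulVg.
exists (fun x => (act (true, 0%N, 1%g) x).1.1); split=> x g.
  rewrite actM actG; case: (act _ x) => [[t n] k] /= -> ag.
  exact: aGo ag.
rewrite actM actH; case: (act _ x) => [[t n] k] /= /negbTE -> /negbTE ag.
exact: aHo ag.
Qed.

(** The universal property maps [F] to the subgroup generated by the factors. Followed by the
    inclusion, this map agrees with the identity on both factors, so by uniqueness it is the
    identity. *)
Lemma amalgam_generated (x : F) : exists w : seq (G + H), word_eval jG jH w = x.
Proof.
pose S : {pred F} := fun x => `[< exists w : seq (G + H), word_eval jG jH w = x >].
have SP y : y \in S -> exists w : seq (G + H), word_eval jG jH w = y.
  by rewrite unfold_in => /asboolP.
have SE w : word_eval jG jH w \in S by rewrite unfold_in; apply/asboolP; exists w.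
have SM y z : y \in S -> z \in S -> (y * z)%g \in S.
  move=> /SP[v <-] /SP[w <-]; have := SE (v ++ w).
  by rewrite /word_eval big_cat.
have Sl (s : G + H) : match s with inl x => jG x | inr y => jH y end \in S.
  by have := SE [:: s]; rewrite /word_eval big_seq1.
have S1 : 1%g \in S by have := SE [::]; rewrite /word_eval big_nil.
have SV y : y \in S -> y^-1%g \in S.
  move=> /SP[w <-]; elim: w => [|s w IHw]; rewrite /word_eval ?big_nil ?invg1//.
  rewrite big_cons invgM SM//.
  case: s => g; [have := Sl (inl g^-1%g)|have := Sl (inr g^-1%g)];
    by rewrite /= gmulfV_group.
have Sgrp : group_closed S.
  by split=> // y z yS zS; rewrite SM// SV.
pose subS := {y | y \in S}.
pose sg : groupType := HB.pack subS (SubChoice_isSubGroup.Build F S subS Sgrp).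
have SG g : jG g \in S := Sl (inl g).
have SH h : jH h \in S := Sl (inr h).
pose f g : sg := exist _ (jG g) (SG g).
pose f' h : sg := exist _ (jH h) (SH h).
have fM : {morph f : x y / (x * y)%g}.
  by move=> y z; apply: val_inj; rewrite /= gmulfM.
have f'M : {morph f' : x y / (x * y)%g}.
  by move=> y z; apply: val_inj; rewrite /= gmulfM.
pose fm : {multiplicative G -> sg} := HB.pack f (isMultiplicative.Build G sg f fM).
pose f'm : {multiplicative H -> sg} := HB.pack f' (isMultiplicative.Build H sg f' f'M).
have [|r [rG rH _]] := F_amalgam.2 sg fm f'm.
  by move=> k; apply: val_inj; rewrite /= F_amalgam.1.
pose u (y : F) : F := sval (r y).
have uM : {morph u : x y / (x * y)%g} by move=> y z; rewrite /u gmulfM.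
pose um : {multiplicative F -> F} := HB.pack u (isMultiplicative.Build F F u uM).
have idM : {morph (@id F) : x y / (x * y)%g} by [].
pose im : {multiplicative F -> F} := HB.pack (@id F) (isMultiplicative.Build F F id idM).
have [|s [_ _ s_uniq]] := F_amalgam.2 F jG jH; first exact: F_amalgam.1.
have us : um =1 s by apply: s_uniq => y /=; rewrite /u ?rG ?rH.
have ids : im =1 s by apply: s_uniq.
have := SP _ (svalP (r x)).
have -> // : sval (r x) = x by rewrite -[LHS]/(um x) us -ids.
Qed.
End Amalgam.

(** * Finitely supported probability measures *)

Section L1.
Variables (R : realType) (X : choiceType).
Implicit Types (f g h : X -> R) (W U : {fset X}).

(** Bounding all finite partial sums bounds the l^1 norm of [f - g] without an infinite sum. *)
Definition l1_le f g (e : R) :=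
  forall U : {fset X}, \sum_(z <- U) `|f z - g z| <= e.

Definition prob_on W f :=
  [/\ forall z, 0 <= f z, forall z, z \notin W -> f z = 0
    & \sum_(z <- W) f z = 1].

Definition avg (n : nat) (f : nat -> X -> R) : X -> R :=
  fun z => (\sum_(i < n) f i z) / n%:R.

Lemma l1_le_sym f g e : l1_le f g e -> l1_le g f e.
Proof. by move=> fg U; under eq_bigr do rewrite distrC; apply: fg. Qed.

Lemma l1_le_trans g f h a b : l1_le f g a -> l1_le g h b -> l1_le f h (a + b).
Proof.
move=> fg gh U; apply: le_trans (lerD (fg U) (gh U)).
by rewrite -big_split; apply: ler_sum => z _; apply: ler_distD.
Qed.

Lemma l1_le_mono a b f g : a <= b -> l1_le f g a -> l1_le f g b.
Proof. by move=> ab fg U; apply: le_trans (fg U) ab. Qed.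

Lemma l1_le_refl f : l1_le f f 0.
Proof. by move=> U; rewrite big1// => z _; rewrite subrr normr0. Qed.

Lemma l1_le_avg n (f g : nat -> X -> R) (e : nat -> R) :
  (forall i, (i < n)%N -> l1_le (f i) (g i) (e i)) ->
  l1_le (avg n f) (avg n g) ((\sum_(i < n) e i) / n%:R).
Proof.
move=> fg U; apply: le_trans (_ : (\sum_(i < n) \sum_(z <- U) `|f i z - g i z|) / n%:R <= _).
  rewrite exchange_big mulr_suml /=; apply: ler_sum => z _.
  rewrite /avg -mulrBl normrM [X in _ * X]ger0_norm ?invr_ge0//.
  by rewrite ler_wpM2r ?invr_ge0// -sumrB ler_norm_sum.
by rewrite ler_wpM2r ?invr_ge0//; apply: ler_sum => i _; apply: fg.
Qed.

Lemma prob_on_sum_le W f U : prob_on W f -> \sum_(z <- U) f z <= 1.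
Proof.
case=> f0 fW f1; rewrite -f1.
have WWU : (W `<=` W `|` U)%fset by apply: fsubsetUl.
rewrite [leRHS](_ : _ = \sum_(z <- W `|` U) f z); last first.
  by apply: (big_fset_incl _ WWU) => z _ /fW.
rewrite [leRHS](bigID (mem U)) /= [X in _ <= X + _]big_fset_condE (_ : [fset i in _ | _] = U).
  by rewrite lerDl sumr_ge0.
by apply/fsetP => z; rewrite !inE/= andbC; case: (z \in U); rewrite ?orbT.
Qed.

Lemma l1_le_prob W W' f g : prob_on W f -> prob_on W' g -> l1_le f g 2.
Proof.
move=> pf pg U; have [f0 _ _] := pf; have [g0 _ _] := pg.
apply: le_trans (lerD (prob_on_sum_le U pf) (prob_on_sum_le U pg)).
rewrite -big_split; apply: ler_sum => z _ /=.
by rewrite (le_trans (ler_normB _ _))// !ger0_norm.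
Qed.

Lemma prob_on_sub W W' f : (W `<=` W')%fset -> prob_on W f -> prob_on W' f.
Proof.
move=> WW' [f0 fW f1]; split=> // [z zW'|].
  by apply: fW; apply: contra zW' => /(fsubsetP WW').
by rewrite -f1 -(big_fset_incl _ WW')// => z _ /fW.
Qed.

Lemma prob_on_avg n W (f : nat -> X -> R) : (0 < n)%N ->
  (forall i, (i < n)%N -> prob_on W (f i)) -> prob_on W (avg n f).
Proof.
move=> n0 pf; split=> [z|z zW|].
- by rewrite divr_ge0// sumr_ge0// => i _; case: (pf i).
- by rewrite /avg big1 ?mul0r// => i _; case: (pf i) => // _ ->.
rewrite -mulr_suml exchange_big /= (eq_bigr (fun=> 1)) => [|i _]; last first.
  by case: (pf i).
by rewrite sumr_const card_ord divff// pnatr_eq0 -lt0n.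
Qed.

(* The two averages differ in [o] terms at each end. *)
Lemma l1_le_avg_shift n o (f : nat -> X -> R) :
  (forall i, exists W, prob_on W (f i)) ->
  l1_le (avg n f) (avg n (fun i => f (i + o)%N)) ((2 * o)%:R / n%:R).
Proof.
elim: o f => [|o IHo] f pf.
  rewrite (_ : (fun i => f (i + 0)%N) = f); last by apply/funext => i; rewrite addn0.
  by rewrite mul0r; apply: l1_le_refl.
have -> : (2 * o.+1)%:R / n%:R = (2 * o)%:R / n%:R + 2 / n%:R :> R.
  by rewrite -mulrDl -natrD; congr (_%:R / _); lia.
apply: l1_le_trans (IHo f pf) _.
have [W pW] := pf o; have [W' pW'] := pf (n + o)%N.
have fo := l1_le_prob pW pW'.
move=> U; apply: le_trans (_ : (\sum_(z <- U) `|f o z - f (n + o)%N z|) / n%:R <= _); last first.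
  by rewrite ler_wpM2r ?invr_ge0.
rewrite mulr_suml; apply: ler_sum => z _.
rewrite /avg -mulrBl normrM [X in _ * X]ger0_norm ?invr_ge0//.
rewrite ler_wpM2r ?invr_ge0// -sumrB.
suff tel m : \sum_(i < m) (f (i + o)%N z - f (i + o.+1)%N z) = f o z - f (m + o)%N z.
  by rewrite tel.
elim: m => [|m IHm]; first by rewrite big_ord0 add0n subrr.
by rewrite big_ord_recr /= IHm addnS addSn addrA subrK.
Qed.

End L1.

Lemma sum_mem_fset (R : pzSemiRingType) (T : choiceType) (C D : {fset T}) :
  D `<=` C -> \sum_(p <- C) (p \in D)%:R = #|` D|%:R :> R.
Proof.
move=> DC; rewrite -(big_fset_incl _ DC) => [|p _ /negbTE -> //].
rewrite big_seq (eq_bigr (fun=> 1)) => [|p -> //].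
by rewrite -big_seq big_const_seq count_predT iter_addr addr0.
Qed.

(** * Images of uniform measures on finite sets *)

Section Pushforward.
Variables (R : realType) (T X : choiceType).

Definition unif_push (phi : T -> X) (A : {fset T}) : X -> R :=
  fun z => (\sum_(p <- A) (phi p == z)%:R) / #|` A|%:R.

Lemma unif_push_prob phi (A : {fset T}) (W : {fset X}) :
  A != fset0 -> (forall p, p \in A -> phi p \in W) ->
  prob_on W (unif_push phi A).
Proof.
move=> A0 AW; split=> [z|z zW|].
- by rewrite divr_ge0// sumr_ge0.
- rewrite /unif_push big_seq big1 ?mul0r// => p pA.
  by case: eqP => // pz; rewrite -pz AW in zW.
rewrite -mulr_suml exchange_big /= big_seq (eq_bigr (fun=> 1)) => [|p pA]; last first.
  rewrite (big_fsetD1 (phi p)) ?AW//= eqxx big_seq big1 ?addr0// => z.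
  by rewrite !inE => /andP[/negbTE + _]; rewrite eq_sym => ->.
rewrite -big_seq big_const_seq count_predT iter_addr addr0 divff//.
by rewrite pnatr_eq0 cardfs_eq0.
Qed.

(** Taking images does not increase the l^1 distance. Before that, the measures differ by at most
    [1 / #|I|] at each point of the symmetric difference [D], and by [q] at each point of the
    intersection [I]; each region contributes at most [#|D| / #|I|]. *)
Lemma l1_le_unif_push phi (A B : {fset T}) : A `&` B != fset0 ->
  l1_le (unif_push phi A) (unif_push phi B)
    (2 * (#|` (A `\` B) `|` (B `\` A)|%:R / #|` A `&` B|%:R)).
Proof.
move=> AB0; pose C := A `|` B.
pose al (D : {fset T}) p : R := (p \in D)%:R / #|` D|%:R.
have pushE (D : {fset T}) z : (D `<=` C)%fset ->
    unif_push phi D z = \sum_(p <- C) al D p * (phi p == z)%:R.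
  move=> DC; rewrite -(big_fset_incl _ DC) => [|p _ /negbTE pD]; last first.
    by rewrite /al pD !mul0r.
  rewrite /unif_push mulr_suml !big_seq; apply: eq_bigr => p pD.
  by rewrite /al pD mul1r mulrC.
move=> U; apply: le_trans (_ : \sum_(p <- C) `|al A p - al B p| <= _).
  apply: le_trans (_ : \sum_(z <- U) \sum_(p <- C) `|al A p - al B p| * (phi p == z)%:R <= _).
    apply: ler_sum => z _; rewrite !pushE ?fsubsetUl ?fsubsetUr// -sumrB.
    apply: le_trans (ler_norm_sum _ _ _) _; apply: ler_sum => p _.
    by rewrite -mulrBl normrM (ger0_norm (ler0n _ _)).
  rewrite exchange_big /=; apply: ler_sum => p _; rewrite -mulr_sumr ler_piMr//.
  have [pU|pU] := boolP (phi p \in U).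
    rewrite (big_fsetD1 (phi p))//= eqxx big_seq big1 ?addr0// => z.
    by rewrite !inE => /andP[/negbTE + _]; rewrite eq_sym => ->.
  by rewrite big_seq big1// => z zU; case: eqP => // pz; rewrite pz zU in pU.
set D := A `\` B `|` B `\` A; set I := A `&` B.
have I0 : 0 < #|` I|%:R :> R by rewrite ltr0n cardfs_gt0.
have IA : (#|` I| <= #|` A|)%N by rewrite fsubset_leq_card ?fsubsetIl.
have IB : (#|` I| <= #|` B|)%N by rewrite fsubset_leq_card ?fsubsetIr.
have DC : D `<=` C.
  by apply/fsubsetP => p; rewrite !inE => /orP[] /andP[_ ->]; rewrite ?orbT.
have IC : I `<=` C by apply/fsubsetP => p; rewrite !inE => /andP[-> _].
have A0 : 0 < #|` A|%:R :> R by apply: lt_le_trans I0 _; rewrite ler_nat.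
have B0 : 0 < #|` B|%:R :> R by apply: lt_le_trans I0 _; rewrite ler_nat.
set q := `|#|` A|%:R^-1 - #|` B|%:R^-1| : R.
apply: le_trans (_ : \sum_(p <- C) ((p \in D)%:R / #|` I|%:R + (p \in I)%:R * q) <= _).
  apply: ler_sum => p _; rewrite /al !inE.
  case: (p \in A); case: (p \in B); rewrite /= !(mul0r, mul1r, add0r, addr0, subr0, sub0r)//.
  - by rewrite ger0_norm ?invr_ge0// lef_pV2 ?posrE// ler_nat.
  - by rewrite normrN ger0_norm ?invr_ge0// lef_pV2 ?posrE// ler_nat.
  - by rewrite oppr0 normr0.
rewrite big_split /= -!mulr_suml !sum_mem_fset// mulrDl mul1r lerD2l.
have cA : #|` A| = (#|` I| + #|` A `\` B|)%N by rewrite -(cardfsID B A).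
have cB : #|` B| = (#|` I| + #|` B `\` A|)%N by rewrite -(cardfsID A B) fsetIC.
have cD : #|` D| = (#|` A `\` B| + #|` B `\` A|)%N.
  rewrite cardfsU [X in (_ - #|` X|)%N](_ : _ = fset0) ?cardfs0 ?subn0//.
  by apply/fsetP => p; rewrite !inE; case: (p \in A); case: (p \in B).
have -> : q = `|#|` B|%:R - #|` A|%:R| / (#|` A|%:R * #|` B|%:R).
  rewrite /q -[X in _ / X]ger0_norm ?mulr_ge0// -normf_div; congr (`| _ |).
  by field; rewrite !gt_eqF.
rewrite mulrA ler_pdivrMr ?mulr_gt0// mulrAC ler_pdivlMr//.
have dBA : `|#|` B|%:R - #|` A|%:R| <= #|` D|%:R :> R.
  rewrite cA cB cD !natrD ler_norml.
  have := ler0n R #|` A `\` B|; have := ler0n R #|` B `\` A|.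
  by move=> ? ?; apply/andP; split; lra.
rewrite (_ : #|` I|%:R * _ * _ = `|#|` B|%:R - #|` A|%:R| * (#|` I|%:R * #|` I|%:R)); last by ring.
by apply: ler_pM => //; rewrite ?mulr_ge0// ler_pM ?ler_nat// ltW.
Qed.

End Pushforward.

(** * From measures back to property A *)

Section Slab.
Variable X : choiceType.
Implicit Types (W : {fset X}) (a b : X -> nat).

(** Turns integer-valued functions into finite subsets of [X * nat]: a subgraph has one point per
    unit of mass, and the difference of two subgraphs is again a slab. *)
Definition slab W a b : {fset X * nat} :=
  [fset p in [seq (z, n) | z <- enum_fset W, n <- iota (a z) (b z - a z)]].

Lemma in_slab W a b p :
  (p \in slab W a b) = (p.1 \in W) && (a p.1 <= p.2 < b p.1)%N.
Proof.
case: p => z n; rewrite /slab inE /=; apply/allpairsPdep/idP => /=.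
  move=> [z' [n' [z'W + [-> ->]]]]; rewrite mem_iota => /andP[zn zn'].
  by rewrite z'W zn; lia.
move=> /andP[zW /andP[za zb]]; exists z, n; split=> //.
by rewrite mem_iota; lia.
Qed.

Lemma card_slab W a b : #|` slab W a b| = (\sum_(z <- W) (b z - a z))%N.
Proof.
rewrite /slab card_fseq undup_id; last first.
  apply: allpairs_uniq_dep => // [z _|]; first exact: iota_uniq.
  by move=> [z n] [z' n'] _ _ /= [-> ->].
by rewrite size_allpairs_dep sumnE big_map; apply: eq_bigr => z _; rewrite size_iota.
Qed.
End Slab.

(** Multiply the measures by a large integer [M], round down and take subgraphs. Rounding loses at
    most 1 at each point of a support, and bounded geometry bounds the size of the supports, so the
    loss is small against [M]. *)
Lemma property_A_of_kernels (R : realType) (X : choiceType) (d : X -> X -> R) :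
  bounded_geometry d ->
  (forall r e : R, 0 < r -> 0 < e ->
    exists (S : R) (W : X -> {fset X}) (xi : X -> X -> R),
    [/\ forall x, prob_on (W x) (xi x), forall x z, z \in W x -> d x z <= S
      & forall x y, d x y <= r -> l1_le (xi x) (xi y) e]) ->
  property_A d.
Proof.
move=> bg ker r e r0 e0.
(* With [eta <= 1 / 8] the intersections keep at least [5 / 8 * M] points; with [eta <= e / 8] the
   symmetric differences have at most [4 * (M * eta) <= e * (M / 2)]. *)
pose eta := Num.min e 1 / 8.
have m0 : 0 < Num.min e 1 by rewrite lt_min e0 ltr01.
have eta0 : 0 < eta by rewrite /eta; lra.
have eta8 : eta <= 1 / 8 by rewrite ler_pM2r ?invr_gt0// ge_min lexx orbT.
have etae : eta <= e / 8 by rewrite ler_pM2r ?invr_gt0// ge_min lexx.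
have [S [W [xi [pxi WS xil]]]] := ker r eta r0 eta0.
(* [S] need not be positive, whereas [bounded_geometry] speaks of positive radii. *)
pose S' := `|S| + 1.
have S'0 : 0 < S' by rewrite /S' ltr_wpDl.
have [N NP] := bg S' S'0.
have WN x : (#|` W x| <= N)%N.
  have [fB cB] := NP x; apply: leq_trans (ltnW cB).
  apply/fsubset_leq_card/fsubsetP => z /WS dS; rewrite in_fset_set// inE /=.
  by apply: le_trans dS _; rewrite /S' (le_trans (ler_norm S))// lerDl.
(* Makes the total rounding error, at most [N], at most [M * eta]. *)
pose M := Num.bound (N%:R / eta).
have MP : N%:R <= M%:R * eta.
  rewrite -ler_pdivrMr//; apply/ltW/archi_boundP.
  by rewrite divr_ge0// ltW.
have M0 : 0 < M%:R :> R.
  apply: le_lt_trans (archi_boundP _); first by rewrite divr_ge0// ltW.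
  by rewrite divr_ge0// ltW.
pose f x z := Num.truncn (M%:R * xi x z).
have xi0 x z : 0 <= M%:R * xi x z.
  by case: (pxi x) => ? _ _; rewrite mulr_ge0// ltW.
have fP x z : (f x z)%:R <= M%:R * xi x z < (f x z)%:R + 1.
  by rewrite natr1; exact: truncn_itv.
have fW x z : z \notin W x -> f x z = 0%N.
  by case: (pxi x) => _ xW _ /xW; rewrite /f => ->; rewrite mulr0 truncn0.
pose A x := slab (W x) (fun=> 0%N) (f x).
have AD x y : A x `\` A y = slab (W x) (f y) (f x).
  apply/fsetP => -[z n]; rewrite in_fsetD !in_slab /=.
  have [zx|zx] := boolP (z \in W x); rewrite ?andbF//=.
  by have [zy|/fW ->] := boolP (z \in W y); rewrite //= -leqNgt.
have sumW x (g : X -> R) c : (forall z, g z <= c) -> 0 <= c ->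
    \sum_(z <- W x) g z <= c * N%:R.
  move=> gc c0; apply: le_trans (_ : \sum_(z <- W x) c <= _).
    by apply: ler_sum => z _.
  by rewrite big_const_seq count_predT iter_addr addr0 -[leLHS]mulr_natr ler_wpM2l// ler_nat.
have cAD x y : l1_le (xi x) (xi y) eta -> #|` A x `\` A y|%:R <= 2 * (M%:R * eta).
  move=> xy; rewrite AD card_slab natr_sum.
  apply: le_trans (_ : \sum_(z <- W x) (M%:R * `|xi x z - xi y z| + 1) <= _).
    apply: ler_sum => z _.
    have := fP x z; have := fP y z; have := ler_norm (xi x z - xi y z).
    case: (leqP (f x z) (f y z)) => [/eqP ->|fyx].
      by move=> *; rewrite addr_ge0// mulr_ge0// ltW.
    rewrite natrB ?(ltnW fyx)//; nra.
  rewrite big_split /= -mulr_sumr [leRHS](_ : _ = M%:R * eta + M%:R * eta); last by ring.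
  apply: lerD; first by rewrite ler_pM2l//; apply: xy.
  by apply: le_trans (_ : 1 * N%:R <= _); [exact: sumW|rewrite mul1r].
have cA x : M%:R - M%:R * eta <= #|` A x|%:R.
  have sM : \sum_(z <- W x) M%:R * xi x z = M%:R :> R.
    by rewrite -mulr_sumr; case: (pxi x) => _ _ ->; rewrite mulr1.
  rewrite lerBlDl -lerBlDr card_slab natr_sum -{1}sM -sumrB.
  apply: le_trans MP; rewrite -[leRHS]mul1r; apply: sumW => // z.
  by rewrite subn0 lerBlDr addrC ltW//; case/andP: (fP x z).
have Meta : M%:R * eta <= M%:R * (1 / 8) by rewrite ler_pM2l.
have cI x y : l1_le (xi x) (xi y) eta ->
    5 / 8 * M%:R <= #|` A x `&` A y|%:R :> R.
  move=> xy; have := cA x; have := cAD x y xy.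
  by rewrite -(cardfsID (A y) (A x)) natrD; lra.
exists A; split=> [x|x y dxy|].
- rewrite -cardfs_gt0 -(ltr0n R); apply: lt_le_trans (cA x); lra.
- have xy := xil x y dxy; have I0 := cI x y xy.
  have I1 : 0 < #|` A x `&` A y|%:R :> R by apply: lt_le_trans I0; lra.
  split; first by rewrite -cardfs_gt0 -(ltr0n R).
  rewrite ltr_pdivrMr//.
  apply: le_lt_trans (_ : 4 * (M%:R * eta) < _).
    apply: le_trans (_ : #|` A x `\` A y|%:R + #|` A y `\` A x|%:R <= _).
      by rewrite -natrD ler_nat cardfsU leq_subr.
    have := cAD x y xy; have := cAD y x (l1_le_sym xy); lra.
  apply: le_lt_trans (_ : e * (M%:R / 2) < _).
    have : M%:R * eta <= M%:R * (e / 8) by rewrite ler_pM2l.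
    by set u := M%:R * eta; lra.
  rewrite ltr_pM2l//; lra.
exists S => x [z n]; rewrite in_slab => /andP[zW _]; exact: WS.
Qed.

(** * Word lengths *)

Record proper_length (F : groupType) (len : F -> nat) : Prop := ProperLength {
  len_eq0 : forall x, len x = 0%N <-> x = 1%g ;
  lenV : forall x, len x^-1%g = len x ;
  lenM : forall x y, (len (x * y)%g <= len x + len y)%N ;
  len_ball : forall n, finite_set [set x | (len x <= n)%N]
}.

Section WordLength.
Variables (T : Type) (F : groupType) (val : T -> F) (wt : T -> nat).
Hypothesis wt_gt0 : forall t, (0 < wt t)%N.
Hypothesis wtV : forall t, exists2 t', val t' = (val t)^-1%g & wt t' = wt t.
Hypothesis wt_ball : forall n, finite_set [set t | (wt t <= n)%N].
Hypothesis val_gen : forall x, exists w : seq T, (\prod_(t <- w) val t)%g = x.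

Let word_of_length (x : F) (n : nat) : bool :=
  `[< exists2 w : seq T, (\prod_(t <- w) val t)%g = x & (\sum_(t <- w) wt t)%N = n >].

Let word_length_exists x : exists n, word_of_length x n.
Proof.
by have [w wx] := val_gen x; exists (\sum_(t <- w) wt t)%N; apply/asboolP; exists w.
Qed.

Definition word_length x := ex_minn (word_length_exists x).

Lemma word_length_le (w : seq T) :
  (word_length (\prod_(t <- w) val t)%g <= \sum_(t <- w) wt t)%N.
Proof.
rewrite /word_length; case: ex_minnP => m _; apply.
by apply/asboolP; exists w.
Qed.

Lemma word_lengthP x : exists2 w : seq T,
  (\prod_(t <- w) val t)%g = x & (\sum_(t <- w) wt t)%N = word_length x.
Proof. by rewrite /word_length; case: ex_minnP => m /asboolP. Qed.

(** There may be infinitely many letters, but only finitely many of each bounded weight. As weights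
    are positive, removing the first letter of a minimal word lowers the length, and balls are
    finite by induction on the radius. *)
Lemma word_length_proper : proper_length word_length.
Proof.
have le_sizew (w : seq T) : (size w <= \sum_(t <- w) wt t)%N.
  by elim: w => [|t w IHw]; rewrite ?big_nil// big_cons /= -add1n leq_add.
have leV x : (word_length x^-1%g <= word_length x)%N.
  have [w <- <-] := word_lengthP x.
  have [w' <- <-] : exists2 w', (\prod_(t <- w') val t)%g = (\prod_(t <- w) val t)^-1%g
      & (\sum_(t <- w') wt t = \sum_(t <- w) wt t)%N.
    elim: w => [|t w [w' vw' ww']]; first by exists [::]; rewrite !big_nil ?invg1.
    have [t' vt' wt'] := wtV t; exists (rcons w' t').
      by rewrite -cats1 big_cat big_seq1 big_cons invgM /= vw' vt'.
    by rewrite -cats1 big_cat big_seq1 big_cons /= ww' wt' addnC.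
  exact: word_length_le.
split=> [x|x|x y|n].
- split=> [x0|->].
    have [w wx] := word_lengthP x; rewrite x0 => w0; have := le_sizew w.
    by rewrite w0 leqn0 => /nilP w0'; rewrite -wx w0' big_nil.
  by apply/eqP; rewrite -leqn0; have := word_length_le [::]; rewrite !big_nil.
- by apply/eqP; rewrite eqn_leq leV -{1}[x]invgK leV.
- have [v <- <-] := word_lengthP x; have [w <- <-] := word_lengthP y.
  by rewrite -!big_cat word_length_le.
elim: n => [|n IHn].
  apply: (@sub_finite_set _ _ [set 1%g]); last exact: finite_set1.
  move=> x /=; rewrite leqn0 => /eqP; have [w <-] := word_lengthP x => <- w0.
  by have := le_sizew w; rewrite w0 leqn0 => /nilP ->; rewrite big_nil.
apply: (@sub_finite_set _ _ ([set 1%g] `|`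
    [set (val t * x)%g | t in [set t | (wt t <= n.+1)%N] & x in [set x | (word_length x <= n)%N]])%classic).
  move=> x /=; have [[|t w] <- <- wn] := word_lengthP x; first by left; rewrite big_nil.
  move: wn; rewrite !big_cons => wn; right.
  exists t => /=; first by apply: leq_trans wn; apply: leq_addr.
  exists (\prod_(t <- w) val t)%g => //=; apply: leq_trans (word_length_le w) _.
  by rewrite -ltnS; apply: leq_trans wn; rewrite -add1n leq_add2r.
by rewrite finite_setU; split; [exact: finite_set1|exact: finite_image2].
Qed.

End WordLength.

(** * The metric of a length function *)

Section LengthMetric.
Variables (R : realType) (F : groupType) (len : F -> nat).
Hypothesis lenP : proper_length len.

Definition length_dist (x y : F) : R := (len (x^-1 * y)%g)%:R.

Lemma length_dist_metric : discrete_metric length_dist.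
Proof.
have dist0 x y : length_dist x y = 0 <-> x = y.
  rewrite /length_dist; split=> [/eqP|->]; last first.
    by rewrite mulVg ((len_eq0 lenP 1%g).2 erefl).
  by rewrite pnatr_eq0 => /eqP/(len_eq0 lenP) xy; rewrite -[y](mulVKg x) xy mulg1.
split=> // [x y|x y z|x].
- by rewrite /length_dist -(lenV lenP) invgM invgK.
- rewrite /length_dist -natrD ler_nat.
  by rewrite (leq_trans _ (lenM lenP _ _))// mulgA mulgK.
exists 1 => // y; rewrite /length_dist -[1]/(1%:R) ltr_nat ltnS leqn0 => /eqP l0.
by apply/esym/dist0; rewrite /length_dist l0.
Qed.

Lemma length_dist_left_invariant : left_invariant length_dist.
Proof. by move=> h g g'; rewrite /length_dist invgM -mulgA mulKg. Qed.

Lemma length_dist_bounded_geometry : bounded_geometry length_dist.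
Proof.
move=> r r0; pose n := Num.truncn r.
pose B := [set x : F | (len x <= n)%N].
have fB : finite_set B := len_ball lenP n.
exists (#|` fset_set B|).+1 => x /=.
have -> : [set y | length_dist x y <= r] = [set (x * b)%g | b in B].
  apply/seteqP; split=> [y /= xy|_ [b /= Bb <-]].
    exists (x^-1 * y)%g; last by rewrite mulVKg.
    by rewrite /B /= /n truncn_ge_nat// ltW.
  by rewrite /length_dist mulKg -truncn_ge_nat// ltW.
split; first exact: finite_image.
by rewrite ltnS fset_set_image// leq_imfset_card.
Qed.
End LengthMetric.

(** * Walks towards the root *)

(** The thresholds counted lie between the smaller of [a] and [b], included, and the larger,
    excluded. *)
Lemma sum_leq_neq (T a b : nat) :
  (\sum_(t < T) ((a <= t) != (b <= t)) <= maxn a b - minn a b)%N.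
Proof.
suff -> : (\sum_(t < T) ((a <= t) != (b <= t)) = minn T (maxn a b) - minn T (minn a b))%N.
  lia.
by elim: T => [|T IHT]; rewrite ?big_ord0 ?big_ord_recr /= ?IHT; lia.
Qed.

(* Almost invariance of [m] along the left cosets of [A] only, as opposed to on
   the whole of [F]. *)
Definition coset_kernels (R : realType) (F : groupType) (len : F -> nat)
    (A : set F) : Prop :=
  forall (r : nat) (e : R), 0 < e ->
  exists (S : nat) (W : F -> {fset F}) (m : F -> F -> R),
  [/\ forall y, prob_on (W y) (m y),
      forall y z, z \in W y -> (len (y^-1 * z)%g <= S)%N
    & forall y a, A a -> (len a <= r)%N -> l1_le (m y) (m (y * a)%g) e].

Section OrientedCosets.
Variables (R : realType) (F : groupType) (len : F -> nat).
Hypothesis lenP : proper_length len.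
Variables (A : bool -> set F) (o : F -> bool).
Hypothesis sA : forall b, is_subgroup (A b).
Hypothesis orient : forall b x a,
  A b a -> o x = b -> o (x * a)%g = b -> A (~~ b) a.

(* A vertex [(b, c)] stands for the coset [c * A b]. *)
Definition vert (b : bool) (x : F) : bool * F := (b, coset_rep (A b) x).

Definition in_vert (v : bool * F) : set F := [set x | A v.1 (v.2^-1 * x)%g].

Lemma in_vert_vert b x : in_vert (vert b x) x.
Proof. exact: coset_repV. Qed.

Lemma vert_eq b x y : A b (x^-1 * y)%g -> vert b x = vert b y.
Proof. by move=> xy; rewrite /vert (coset_rep_eq (sA b) xy). Qed.

Lemma in_vertD v x y : in_vert v x -> in_vert v y -> A v.1 (x^-1 * y)%g.
Proof.
by move=> vx vy; have := (sA _).2 _ _ vx vy; rewrite invgM invgK mulgA mulgK.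
Qed.

(** [xget] picks any edge leaving [v]; by [orient] all such edges have the same other end. A vertex
    that no edge leaves is its own parent. *)
Definition parent (v : bool * F) : bool * F :=
  let P := (in_vert v `&` [set x | o x = v.1])%classic in
  if `[< exists x, P x >] then vert (~~ v.1) (xget 1%g P) else v.

Lemma parent_vert b x : o x = b -> parent (vert b x) = vert (~~ b) x.
Proof.
move=> ox; rewrite /parent; set P := (X in xget _ X).
have Px : P x by split=> //; exact: in_vert_vert.
rewrite asboolT; last by exists x.
have [vy oy] : P (xget 1%g P) by apply: xgetI Px.
apply: vert_eq; apply: (orient (b := b) (x := xget 1%g P)) => //.
  exact: (in_vertD vy (in_vert_vert b x)).
by rewrite mulVKg.
Qed.

Lemma near_exists x v : exists p, in_vert v p /\
  forall q, in_vert v q -> (len (x^-1 * p)%g <= len (x^-1 * q)%g)%N.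
Proof.
pose P n := `[< exists2 p, in_vert v p & len (x^-1 * p)%g = n >].
have exP : exists n, P n.
  by exists (len (x^-1 * v.2)%g); apply/asboolP; exists v.2; rewrite // /in_vert /= mulVg; apply: (sA _).1.
case: (ex_minnP exP) => n /asboolP[p vp pn] nmin; exists p; split=> // q vq.
by rewrite pn nmin//; apply/asboolP; exists q.
Qed.

Definition near x v : F := sval (cid (near_exists x v)).

(** The distance from [x] to the coset [v]. *)
Definition gap x v : nat := len (x^-1 * near x v)%g.

Lemma near_in x v : in_vert v (near x v).
Proof. by rewrite /near; case: cid => p []. Qed.

Lemma gap_le x v q : in_vert v q -> (gap x v <= len (x^-1 * q)%g)%N.
Proof. by rewrite /gap /near => vq; case: cid => p [_ p_min] /=; exact: p_min. Qed.

Lemma gap_lip x s v : (gap (x * s)%g v <= gap x v + len s)%N.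
Proof.
apply: leq_trans (gap_le _ (near_in x v)) _.
by rewrite invgM -mulgA (leq_trans (lenM lenP _ _))// (lenV lenP) addnC.
Qed.

Lemma gap_vert b x : gap x (vert b x) = 0%N.
Proof.
apply/eqP; rewrite -leqn0; apply: leq_trans (gap_le _ (in_vert_vert b x)) _.
by rewrite mulVg ((len_eq0 lenP 1%g).2 erefl).
Qed.

(** A step once refused is refused for ever, so a stopped walk repeats its last vertex. *)
Definition step t x v := if (gap x (parent v) <= t)%N then parent v else v.

Definition walk t x j := iter j (step t x) (vert true x).

Lemma gap_walk t x j : (gap x (walk t x j) <= t)%N.
Proof.
rewrite /walk; elim: j => [|j IHj] /=; first by rewrite gap_vert.
by rewrite {1}/step; case: ifP.
Qed.

(** For [b = true] the starts coincide. Otherwise both starts are adjacent to [vert false x], and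
    the values of [o] at [x] and [x * s] decide whether the walks meet there, at one of the starts,
    or at once, both starts being its parent. With [L <= t] none of these steps is refused. *)
Lemma walk_merge L b x s : A b s -> (len s <= L)%N ->
  exists v i j, [/\ (i <= 2)%N, (j <= 2)%N
    & forall t, (L <= t)%N -> walk t x i = v /\ walk t (x * s)%g j = v].
Proof.
move=> As sL.
have vb : vert b x = vert b (x * s)%g by apply: vert_eq; rewrite mulKg.
case: b As vb => As vb; first by exists (vert true x), 0%N, 0%N; split=> // t _; rewrite /walk /= vb.
have gs : (gap x (vert true (x * s)%g) <= L)%N.
  apply: leq_trans (gap_le _ (in_vert_vert true _)) _.
  by rewrite mulKg.
have gx : (gap (x * s)%g (vert true x) <= L)%N.
  apply: leq_trans (gap_le _ (in_vert_vert true _)) _.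
  by rewrite invgM mulgVK (lenV lenP).
have g0 : gap x (vert false (x * s)%g) = 0%N by rewrite -vb gap_vert.
have g0' : gap (x * s)%g (vert false x) = 0%N by rewrite vb gap_vert.
case ox: (o x); case oxs: (o (x * s)%g).
- exists (vert false x), 1%N, 1%N; split=> // t Lt.
  by rewrite /walk /= /step !parent_vert// /= -vb g0' gap_vert.
- exists (vert true (x * s)%g), 2, 0%N; split=> // t Lt; split=> //.
  rewrite /walk /= {2}/step parent_vert//= gap_vert /step vb parent_vert//=.
  by rewrite (leq_trans gs).
- exists (vert true x), 0%N, 2; split=> // t Lt; split=> //.
  rewrite /walk /= {2}/step parent_vert//= gap_vert /step -vb parent_vert//=.
  by rewrite (leq_trans gx).
exists (vert true x), 0%N, 0%N; split=> // t Lt; split=> //.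
by rewrite /walk /= -(parent_vert (b := false) ox) vb parent_vert.
Qed.

(** From [v] on, both walks test the same ancestors with the same outcome; [k] counts the steps
    really taken. *)
Lemma walk_eq n t x y v i j : walk t x i = v -> walk t y j = v ->
  (forall k, (k < n)%N ->
    (gap x (iter k.+1 parent v) <= t)%N = (gap y (iter k.+1 parent v) <= t)%N) ->
  forall l, (l <= n)%N -> walk t x (l + i)%N = walk t y (l + j)%N.
Proof.
move=> xi yj gxy l ln; rewrite /walk !iterD -!/(walk _ _ _) xi yj.
suff [k kl [-> ->]] : exists2 k, (k <= l)%N &
  iter l (step t x) v = iter k parent v /\ iter l (step t y) v = iter k parent v by [].
elim: l ln => [|l IHl] ln; first by exists 0%N.
have [k kl [/= -> ->]] := IHl (ltnW ln).
rewrite /step -!iterS gxy; last by apply: leq_trans ln.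
by case: ifP => _; [exists k.+1|exists k; rewrite // leqW].
Qed.

(** * Averaging measures along the walks *)

Hypothesis kerA : forall b, coset_kernels R len (A b).

Lemma one_step_kernels (L : nat) (e : R) : 0 < e ->
  exists (S : nat) (W : F -> {fset F}) (xi : F -> F -> R),
  [/\ forall x, prob_on (W x) (xi x),
      forall x z, z \in W x -> (len (x^-1 * z)%g <= S)%N
    & forall b x s, A b s -> (len s <= L)%N -> l1_le (xi x) (xi (x * s)%g) e].
Proof.
move=> e0.
have e30 : 0 < e / 3 by rewrite divr_gt0.
have big_nat (c : R) : 0 <= c -> exists2 n : nat, (0 < n)%N & c / n%:R <= e / 3.
  move=> c0; have c3 : 0 <= c / (e / 3) by rewrite divr_ge0// ltW.
  have := archi_boundP c3; set n := Num.bound _ => cn.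
  have n0 : (0 < n)%N by rewrite -(ltr0n R); apply: le_lt_trans cn.
  exists n => //; rewrite ler_pdivrMr ?ltr0n//.
  by rewrite -ler_pdivrMl// mulrC ltW.
(* The error splits in three: [8 / n] for two shifts by at most 2, [e / 3] from [kerA], and 2 for
   each of at most [n.+1 * L] bad thresholds out of [T]. *)
have [n n0 nP] := big_nat 8 (ler0n _ _).
have [T T0 TP] := big_nat (2 * (n.+1 * L)%:R) (mulr_ge0 (ler0n _ _) (ler0n _ _)).
(* Two points of a coset at distance at most [T] from [x] and from [x * s] are at distance at most
   [T + L + T] from each other. *)
have /choice[S /choice[W /choice[m mP]]] := fun b => kerA b (2 * T + L)%N e30.
pose mu t x j : F -> R := m (walk t x j).1 (near x (walk t x j)).
pose S' := (T + maxn (S true) (S false))%N.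
pose B := [set z : F | (len z <= S')%N].
have fB x : finite_set [set (x * z)%g | z in B] by apply: finite_image; exact: len_ball.
pose W' x := fset_set [set (x * z)%g | z in B].
have inW' x z : (z \in W' x) = (len (x^-1 * z)%g <= S')%N.
  rewrite in_fset_set//; apply/idP/idP; rewrite inE /=.
    by move=> [b Bb <-]; rewrite mulKg.
  by move=> xz; exists (x^-1 * z)%g; rewrite ?mulVKg.
have pmu t x j : (t < T)%N -> prob_on (W' x) (mu t x j).
  move=> tT; rewrite /mu; set v := walk t x j.
  have [pm mS _] := mP v.1; apply: prob_on_sub (pm _).
  apply/fsubsetP => z /mS zS; rewrite inW'.
  have gv : (gap x v <= T)%N by apply: leq_trans (gap_walk _ _ _) (ltnW tT).
  rewrite -(mulVKg (near x v) z) mulgA (leq_trans (lenM lenP _ _))// leq_add//.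
  apply: leq_trans zS _; by case: (v.1); rewrite ?leq_maxl ?leq_maxr.
pose xi x := avg T (fun t => avg n (mu t x)).
exists S', W', xi; split=> [x|x z|b x s As sL].
- by apply: prob_on_avg => // t tT; apply: prob_on_avg => // j _; exact: pmu.
- by rewrite inW'.
have [v [i [j [i2 j2 vP]]]] := walk_merge x As sL.
set y := (x * s)%g.
pose split_at t k := (gap x (iter k.+1 parent v) <= t)%N != (gap y (iter k.+1 parent v) <= t)%N.
(* Below [L] the walks may fail to merge; otherwise [t] is bad when it separates the gaps to one of
   the first [n] proper ancestors of the meeting vertex. *)
pose bad t := (t < L)%N || [exists k : 'I_n, split_at t k].
have l1_good t : (t < T)%N -> ~~ bad t ->
    l1_le (avg n (mu t x)) (avg n (mu t y)) (8 / n%:R + e / 3).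
  rewrite negb_or -leqNgt => tT /andP[Lt /existsPn ns].
  have [xv yv] := vP t Lt.
  have shift x' i' : (i' <= 2)%N ->
      l1_le (avg n (mu t x')) (avg n (fun l => mu t x' (l + i')%N)) (4 / n%:R).
    move=> i'2; apply: l1_le_mono (l1_le_avg_shift _ _ _).
      by rewrite ler_wpM2r ?invr_ge0// ler_nat; lia.
    by move=> l; exists (W' x'); exact: pmu.
  have -> : 8 / n%:R + e / 3 = 4 / n%:R + e / 3 + 4 / n%:R :> R by lra.
  apply: l1_le_trans (l1_le_sym (shift y j j2)).
  apply: l1_le_trans (shift x i i2) _.
  have -> : e / 3 = (\sum_(l < n) (e / 3)) / n%:R.
    by rewrite sumr_const card_ord -[e / 3 *+ n]mulr_natr mulfK// pnatr_eq0 -lt0n.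
  apply: (@l1_le_avg _ _ n (fun l => mu t x (l + i)%N)
    (fun l => mu t y (l + j)%N) (fun=> e / 3)) => l ln; rewrite /mu.
  have wxy : walk t x (l + i)%N = walk t y (l + j)%N.
    apply: (walk_eq (n := n) xv yv) (ltnW ln) => k kn.
    by have := ns (Ordinal kn); rewrite /split_at negbK => /eqP.
  rewrite wxy; set u := walk t y (l + j)%N.
  have gx : (gap x u <= T)%N by rewrite /u -wxy (leq_trans (gap_walk _ _ _))// ltnW.
  have gy : (gap y u <= T)%N by rewrite (leq_trans (gap_walk _ _ _))// ltnW.
  have [_ _ mA] := mP u.1.
  rewrite -(mulVKg (near x u) (near y u)); apply: mA.
    exact: (in_vertD (near_in _ _) (near_in _ _)).
  have -> : ((near x u)^-1 * near y u)%g =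
      ((x^-1 * near x u)^-1 * (s * (y^-1 * near y u)))%g.
    by rewrite /y !invgM !invgK !mulgA !mulgK.
  apply: leq_trans (lenM lenP _ _) _; rewrite (lenV lenP).
  have := lenM lenP s (y^-1 * near y u)%g.
  by move: gx gy; rewrite /gap; lia.
have l1_t t : (t < T)%N ->
    l1_le (avg n (mu t x)) (avg n (mu t y)) (8 / n%:R + e / 3 + 2 * (bad t)%:R).
  move=> tT; case bt: (bad t); last first.
    by rewrite mulr0 addr0; apply: l1_good; rewrite ?bt.
  (* For a bad [t], the trivial distance between probability measures. *)
  apply: (@l1_le_mono _ _ 2); first by rewrite mulr1 lerDr addr_ge0 ?divr_ge0// ltW.
  by apply: (@l1_le_prob _ _ (W' x) (W' y)); apply: prob_on_avg => // k _; exact: pmu.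
have gapxy u : (gap x u <= gap y u + L)%N /\ (gap y u <= gap x u + L)%N.
  have := gap_lip x s u; have := gap_lip y s^-1%g u.
  by rewrite {1}/y mulgK (lenV lenP) -/y; lia.
(* At most [L] thresholds lie below [L], and at most [L] separate the gaps to each of the [n]
   ancestors, by [gapxy]. *)
have n_bad : (\sum_(t < T) bad t <= n.+1 * L)%N.
  apply: leq_trans (_ : \sum_(t < T) ((0 <= t) != (L <= t)) +
      \sum_(t < T) \sum_(k < n) split_at t k <= _)%N.
    rewrite -big_split; apply: leq_sum => t _ /=; rewrite /bad ltnNge.
    case: (L <= t)%N => //=; case: existsP => //= -[k kt].
    by rewrite add0n (bigD1 k)//= kt.
  rewrite mulSn leq_add//; first by apply: leq_trans (sum_leq_neq _ _ _) _; lia.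
  rewrite exchange_big /=; apply: leq_trans (_ : \sum_(k < n) L <= _)%N.
    apply: leq_sum => k _; apply: leq_trans (sum_leq_neq _ _ _) _.
    by have := gapxy (iter k.+1 parent v); lia.
  by rewrite sum_nat_const card_ord.
apply: l1_le_mono (l1_le_avg l1_t).
rewrite big_split /= sumr_const card_ord -[_ *+ T]mulr_natr mulrDl mulfK ?pnatr_eq0 -?lt0n//.
rewrite -mulr_sumr -natr_sum.
have : 2 * (\sum_(t < T) bad t)%:R / T%:R <= e / 3.
  apply: le_trans TP; rewrite ler_wpM2r ?invr_ge0// ler_wpM2l// ler_nat.
  exact: n_bad.
move: nP; lra.
Qed.

Lemma walk_kernels (L : nat) (e : R) : 0 < e ->
  (forall n x, (len x <= n)%N -> exists w : seq F,
     [/\ (\prod_(s <- w) s)%g = x, (size w <= n)%N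
       & forall s, s \in w -> (len s <= n)%N /\ exists b, A b s]) ->
  exists (S : nat) (W : F -> {fset F}) (xi : F -> F -> R),
  [/\ forall x, prob_on (W x) (xi x),
      forall x z, z \in W x -> (len (x^-1 * z)%g <= S)%N
    & forall x y, (len (x^-1 * y)%g <= L)%N -> l1_le (xi x) (xi y) e].
Proof.
(* At most [L] letters lead from [x] to [y], each costing [e / L.+1]; the successor avoids dividing
   by zero. *)
move=> e0 gen; have e'0 : 0 < e / L.+1%:R by rewrite divr_gt0.
have [S [W [xi [pxi xiS xi1]]]] := one_step_kernels L e'0.
exists S, W, xi; split=> // x y xy.
have [w [wxy wL ws]] := gen L _ xy.
have -> : y = (x * \prod_(s <- w) s)%g by rewrite wxy mulVKg.
apply: (@l1_le_mono _ _ ((size w)%:R * (e / L.+1%:R))).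
  by rewrite mulrC -mulrA ler_piMr ?(ltW e0)// ler_pdivrMl// mulr1 ler_nat ltnW.
elim: w ws x {xy wxy wL} => [|s w IHw] ws x.
  by rewrite big_nil mulg1 mul0r; exact: l1_le_refl.
have [sL [b As]] := ws s (mem_head _ _).
rewrite big_cons mulgA -[size _]add1n natrD mulrDl mul1r.
apply: l1_le_trans (xi1 b x s As sL) _; apply: IHw => s' s'w.
by apply: ws; rewrite inE s'w orbT.
Qed.
End OrientedCosets.

(** * Amalgams *)

Lemma finite_set_ubound (R : realType) (T : choiceType) (A : set T) (f : T -> R) :
  finite_set A -> exists2 D : R, 0 < D & forall x, A x -> f x <= D.
Proof.
move=> fA; exists (1 + \sum_(x <- fset_set A) `|f x|) => [|x Ax].
  by rewrite ltr_pwDl// sumr_ge0.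
rewrite (big_fsetD1 x) /=; last by rewrite in_fset_set// inE.
have : 0 <= \sum_(y <- fset_set A `\ x) `|f y| by rewrite sumr_ge0.
have := ler_norm (f x); lra.
Qed.

(** Each coset is identified with [G] through its representative, and the sets given by property A
    are carried over, forgetting their labels in [nat]. A [len]-ball of [G] is finite, hence bounded
    for [d]; the last hypothesis is the converse comparison. *)
Lemma range_coset_kernels (R : realType) (G F : groupType) (len : F -> nat)
    (j : {multiplicative G -> F}) (d : G -> G -> R) :
  proper_length len -> injective j -> left_invariant d -> property_A d ->
  (forall D : R, exists N : nat, forall g, d 1%g g <= D -> (len (j g) <= N)%N) ->
  coset_kernels R len (range j).
Proof.
move=> lenP j_inj dinv dA len_le r e e0.
have sj := range_subgroup j.
have fr : finite_set [set g | (len (j g) <= r)%N].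
  have := finite_preimage (in2W j_inj) (len_ball lenP r); apply: sub_finite_set.
  by [].
have [D D0 DP] := finite_set_ubound (d 1%g) fr.
(* Halved because of the factor 2 in [l1_le_unif_push]. *)
have e20 : 0 < e / 2 by rewrite divr_gt0.
have [A [A0 Ad [S0 AS]]] := dA D (e / 2) D0 e20.
have [N NP] := len_le S0.
pose c := coset_rep (range j).
have /choice[gam gamP] : forall y, exists g, (c y * j g)%g = y.
  by move=> y; have [g _ cg] := coset_repV sj y; exists g; rewrite cg mulVKg.
pose phi y (p : G * nat) := (c y * j p.1)%g.
exists N, (fun y => [fset phi y p | p in A (gam y)]), (fun y => unif_push R (phi y) (A (gam y))).
split=> [y|y z|y _ [g _ <-] gr].
- by apply: unif_push_prob => // p pA; apply/imfsetP; exists p.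
- move=> /imfsetP[p /= pA ->]; rewrite -{1}(gamP y) /phi invgM -mulgA mulKg.
  rewrite -gmulfV_group -gmulfM; apply: NP.
  by rewrite -(dinv (gam y)) mulg1 mulVKg; exact: AS.
have cE : c (y * j g)%g = c y.
  by apply/esym/(coset_rep_eq sj); rewrite mulKg; exists g.
have gE : gam (y * j g)%g = (gam y * g)%g.
  apply: j_inj; apply: (mulgI (c y)).
  by rewrite -{1}cE gamP gmulfM mulgA gamP.
have dg : d (gam y) (gam y * g)%g <= D.
  by rewrite -{1}[gam y]mulg1 dinv; exact: DP.
have [AI Aq] := Ad _ _ dg.
have -> : phi (y * j g)%g = phi y by rewrite /phi cE.
rewrite gE; apply: l1_le_mono (l1_le_unif_push R (phi y) AI).
move: Aq; set q := _ / _; lra.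
Qed.

Lemma finite_truncn_ball (R : realType) (G : groupType) (d : G -> G -> R) n :
  bounded_geometry d -> finite_set [set g | ((Num.truncn (d 1%g g)).+1 <= n)%N].
Proof.
move=> bg; have n0 : 0 < n%:R + 1 :> R by rewrite ltr_wpDl.
have [N /(_ 1%g)[fB _]] := bg _ n0.
apply: sub_finite_set fB => g /= gn.
apply: ltW; apply: lt_trans (truncnS_gt _) _.
by rewrite natr1 ltr_nat.
Qed.

Theorem theorem2p3p11 (R : realType) (K G H F : groupType)
    (iG : {multiplicative K -> G}) (iH : {multiplicative K -> H})
    (jG : {multiplicative G -> F}) (jH : {multiplicative H -> F})
    (iG_inj : injective iG) (iH_inj : injective iH)
    (F_amalgam : is_amalgam iG iH jG jH)
    (G_countable : countable [set: G]) (H_countable : countable [set: H])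
    (G_A : group_property_A R G) (H_A : group_property_A R H) :
  group_property_A R F.
Proof.
have [jG_inj jH_inj [o [oG oH]]] :=
  amalgam_orientation F_amalgam iG_inj iH_inj G_countable H_countable.
have [dG [mG lG bG aG]] := G_A; have [dH [mH lH bH aH]] := H_A.
pose val (t : G + H) : F := match t with inl g => jG g | inr h => jH h end.
(* The successor makes all weights positive, even that of the unit. *)
pose wt (t : G + H) : nat :=
  match t with
  | inl g => (Num.truncn (dG 1%g g)).+1
  | inr h => (Num.truncn (dH 1%g h)).+1
  end.
have wt_gt0 t : (0 < wt t)%N by case: t.
have distV (Q : groupType) (d : Q -> Q -> R) : discrete_metric d -> left_invariant d ->
    forall x, d 1%g x^-1%g = d 1%g x.
  by move=> m l x; rewrite -(l x) mulg1 mulgV (dist_sym m).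
have wtV t : exists2 t', val t' = (val t)^-1%g & wt t' = wt t.
  by case: t => x; [exists (inl x^-1%g)|exists (inr x^-1%g)];
    rewrite /= ?gmulfV_group ?distV.
have wt_ball n : finite_set [set t | (wt t <= n)%N].
  apply: (@sub_finite_set _ _ (inl @` [set g | ((Num.truncn (dG 1%g g)).+1 <= n)%N] `|`
     inr @` [set h | ((Num.truncn (dH 1%g h)).+1 <= n)%N])%classic).
    by case=> x xn; [left|right]; exists x.
  by rewrite finite_setU; split; apply: finite_image; exact: finite_truncn_ball.
have val_gen x : exists w : seq (G + H), (\prod_(t <- w) val t)%g = x :=
  amalgam_generated F_amalgam x.
pose len := word_length wt val_gen.
have lenP : proper_length len by exact: word_length_proper.
have len_val t : (len (val t) <= wt t)%N.
  by have := word_length_le wt val_gen [:: t]; rewrite !big_seq1.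
pose A b : set F := if b then range jG else range jH.
have sA b : is_subgroup (A b) by case: b; exact: range_subgroup.
(* An element of one factor joining two edges that leave the same vertex comes from [K], hence lies
   in the other factor. *)
have orient b x a : A b a -> o x = b -> o (x * a)%g = b -> A (~~ b) a.
  case: b => -[g _ <-] /= ox oxa.
    by have [|k _ <-] := oG x g ox; rewrite ?oxa//; exists (iH k) => //; rewrite F_amalgam.1.
  by have [||k _ <-] := oH x g; rewrite ?ox ?oxa//; exists (iG k) => //; rewrite F_amalgam.1.
have kerA b : coset_kernels R len (A b).
  case: b.
    apply: range_coset_kernels lenP jG_inj lG aG _ => D.
    exists (Num.truncn D).+1 => g gD; apply: leq_trans (len_val (inl g)) _.
    by rewrite ltnS le_truncn.
  apply: range_coset_kernels lenP jH_inj lH aH _ => D.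
  exists (Num.truncn D).+1 => h hD; apply: leq_trans (len_val (inr h)) _.
  by rewrite ltnS le_truncn.
(* In a word of minimal weight, positive weights bound the number of letters, and [len_val] bounds
   the length of each. *)
have gen n x : (len x <= n)%N -> exists w : seq F,
    [/\ (\prod_(s <- w) s)%g = x, (size w <= n)%N
      & forall s, s \in w -> (len s <= n)%N /\ exists b, A b s].
  move=> xn; have [w wx wl] := word_lengthP wt val_gen x.
  have wn : (\sum_(t <- w) wt t <= n)%N by rewrite wl.
  exists (map val w); split.
  - by rewrite big_map.
  - apply: leq_trans wn; rewrite size_map -sum1_size.
    by apply: leq_sum => t _.
  elim: w {wx wl} wn => [//|t w IHw]; rewrite big_cons /= => wn s.
  rewrite inE => /orP[/eqP ->|]; last by apply: IHw; apply: leq_trans wn; exact: leq_addl.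
  split; first by apply: leq_trans (len_val t) _; apply: leq_trans wn; exact: leq_addr.
  by case: t {wn} => g; [exists true|exists false]; exists g.
exists (length_dist R len); split.
- exact: length_dist_metric.
- exact: length_dist_left_invariant.
- exact: length_dist_bounded_geometry.
apply: property_A_of_kernels; first exact: length_dist_bounded_geometry.
move=> r e r0 e0.
(* Lengths are integers, so [r] may be truncated. *)
have [S [W [xi [pxi WS xiL]]]] := walk_kernels lenP sA orient kerA (Num.truncn r) e0 gen.
exists S%:R, W, xi; split=> // [x z zW|x y xy].
  by rewrite /length_dist ler_nat; exact: WS.
by apply: xiL; rewrite truncn_ge_nat// ltW.
Qed.
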